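(* The transformation $(X,Y,R)\mapsto\mathfrak{R}^0$ is a covariant functor $CoShvRep^0:\mathbf{Rel}\to\mathbf{CoShv}$; in particular, each $\mathbf{Rel}$ morphism induces a cosheaf morphism. Furthermore, the restriction of this functor to the subcategory $\mathbf{Rel_+}$ is faithful.
   Context: The category $\mathbf{Rel}$ has as objects triples $(X,Y,R)$ where $X,Y$ are sets and $R\subseteq X\times Y$. A morphism $(X,Y,R)\to(X',Y',R')$ is a pair of functions $f:X\to X'$, $g:Y\to Y'$ such that $(f(x),g(y))\in R'$ whenever $(x,y)\in R$; composition is componentwise. $\mathbf{Rel_+}$ is the full subcategory of objects $(X,Y,R)$ such that every $x\in X$ has some $y\in Y$ with $(x,y)\in R$, and every $y\in Y$ has some $x\in X$ with $(x,y)\in R$. The Dowker complex $D(X,Y,R)$ consists here of the nonempty finite subsets $\sigma\subseteq X$ (simplices) for which there is a $y\in Y$ with $(x,y)\in R$ for all $x\in\sigma$. It is regarded as a partially ordered set under inclusion. For a simplex $\sigma$, $Y_\sigma=\{y\in Y:(x,y)\in R\text{ for all }x\in\sigma\}$; if $\sigma\subseteq\tau$ then $Y_\tau\subseteq Y_\sigma$. A cosheaf of sets $\mathfrak{C}$ on a partially ordered set $(P,\le)$ assigns to each $x\in P$ a set $\mathfrak{C}(x)$ (costalk) and to each $x\le y$ a function $\mathfrak{C}(x\le y):\mathfrak{C}(y)\to\mathfrak{C}(x)$ (extension), forming a contravariant functor from $(P,\le)$ to $\mathbf{Set}$. A cosheaf morphism $m:\mathfrak{C}\to\mathfrak{D}$,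 where $\mathfrak{C}$ is on $P$ and $\mathfrak{D}$ is on $Q$, along an order preserving base map $f:P\to Q$ consists of functions $m_x:\mathfrak{C}(x)\to\mathfrak{D}(f(x))$ for $x\in P$ with $\mathfrak{D}(f(x)\le f(y))\circ m_y=m_x\circ\mathfrak{C}(x\le y)$ for all $x\le y$. $\mathbf{CoShv}$ is the category of cosheaves of sets on partially ordered sets. A morphism is a base map together with its components, and morphisms compose by composing base maps and components. For a relation $(X,Y,R)$, the cosheaf $\mathfrak{R}^0=CoShvRep^0(X,Y,R)$ on $(D(X,Y,R),\subseteq)$ has costalks $\mathfrak{R}^0(\sigma)=Y_\sigma$ and extensions $\mathfrak{R}^0(\sigma\subseteq\tau):Y_\tau\to Y_\sigma$ the inclusions. A $\mathbf{Rel}$ morphism $(f,g):(X_1,Y_1,R_1)\to(X_2,Y_2,R_2)$ is sent to the cosheaf morphism with base map $\sigma\mapsto f(\sigma)$ and components $m_\sigma=g|_{(Y_1)_\sigma}:(Y_1)_\sigma\to(Y_2)_{f(\sigma)}$. *)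

(* Defs.v *)
From HB Require Import structures.
From mathcomp Require Import all_boot all_order.
From mathcomp Require Import boolp classical_sets functions cardinality.

Set Implicit Arguments.
Unset Strict Implicit.
Unset Printing Implicit Defensive.

Local Open Scope classical_set_scope.

(* Sets are rendered by arbitrary types, subsets of T by [set T], and a subset
   used as a type is mathcomp-analysis' [set_type], i.e. {x : T | x \in A}. *)

Record category := Category {
  obj :> Type;
  hom : obj -> obj -> Type;
  idm : forall A, hom A A;
  compm : forall A B C, hom B C -> hom A B -> hom A C;
  comp_idl : forall A B (f : hom A B), compm (idm B) f = f;
  comp_idr : forall A B (f : hom A B), compm f (idm A) = f;
  comp_assoc : forall A B C D (h : hom C D) (g : hom B C) (f : hom A B),
    compm h (compm g f) = compm (compm h g) f }.
Arguments hom {_} _ _.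
Arguments idm {_} _.
Arguments compm {_ _ _ _} _ _.

Record functor_on (C D : category) (F : C -> D) := FunctorOn {
  fmap : forall A B : C, hom A B -> hom (F A) (F B);
  fmap_id : forall A : C, fmap (idm A) = idm (F A);
  fmap_comp : forall (A B E : C) (g : hom B E) (f : hom A B),
    fmap (compm g f) = compm (fmap g) (fmap f) }.
Arguments fmap {C D F} _ {A B} _.

Definition faithful (C D : category) (F : C -> D) (S : functor_on F) : Prop :=
  forall A B : C, injective (@fmap C D F S A B).

Definition full_subcategory (C : category) (P : C -> Prop) : category :=
  @Category {A : C | P A}
    (fun A B => hom (sval A) (sval B))
    (fun A => idm (sval A))
    (fun _ _ _ g f => compm g f)
    (fun _ _ f => comp_idl f)
    (fun _ _ f => comp_idr f)
    (fun _ _ _ _ h g f => comp_assoc h g f).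

Definition functor_restrict (C D : category) (F : C -> D) (S : functor_on F)
    (P : C -> Prop) :
    functor_on (C := full_subcategory P) (fun A => F (sval A)) :=
  @FunctorOn (full_subcategory P) D (fun A => F (sval A))
    (fun _ _ f => fmap S f)
    (fun A => fmap_id S (sval A))
    (fun _ _ _ g f => fmap_comp S g f).

Record relation := Relation {
  rel_X : Type;
  rel_Y : Type;
  rel_R : set (rel_X * rel_Y) }.
Arguments rel_R : clear implicits.

Record rel_hom (A B : relation) := RelHom {
  hom_X : rel_X A -> rel_X B;
  hom_Y : rel_Y A -> rel_Y B;
  rel_homP : forall x y, rel_R A (x, y) -> rel_R B (hom_X x, hom_Y y) }.

Definition rel_id (A : relation) : rel_hom A A :=
  @RelHom A A id id (fun _ _ h => h).

Definition rel_comp (A B C : relation) (n : rel_hom B C) (m : rel_hom A B) :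
    rel_hom A C :=
  @RelHom A C (hom_X n \o hom_X m) (hom_Y n \o hom_Y m)
    (fun _ _ h => rel_homP n (rel_homP m h)).

Definition Rel : category :=
  @Category relation rel_hom rel_id rel_comp
    (fun _ _ m => let: RelHom _ _ _ := m in erefl)
    (fun _ _ m => let: RelHom _ _ _ := m in erefl)
    (fun _ _ _ _ _ _ _ => erefl).

Definition in_Rel_plus (A : Rel) : Prop :=
  (forall x : rel_X A, exists y : rel_Y A, rel_R A (x, y)) /\
  (forall y : rel_Y A, exists x : rel_X A, rel_R A (x, y)).

Definition Rel_plus : category := full_subcategory in_Rel_plus.

Record cosheaf d (P : porderType d) := Cosheaf {
  costalk : P -> Type;
  extension : forall x y : P, (x <= y)%O -> costalk y -> costalk x;
  extension_id : forall (x : P) (h : (x <= x)%O) (c : costalk x),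
    extension h c = c;
  extension_comp : forall (x y z : P) (hxy : (x <= y)%O) (hyz : (y <= z)%O)
      (hxz : (x <= z)%O) (c : costalk z),
    extension hxz c = extension hxy (extension hyz c) }.
Arguments costalk {d P} _ _.
Arguments extension {d P} _ {x y} _ _.

(* The choice structure and display carried by [base] are invisible to
   morphisms; classically every partial order on a type yields a porderType. *)
Record cosheaf_obj := CosheafObj {
  base_disp : Order.disp_t;
  base : porderType base_disp;
  the_cosheaf :> cosheaf base }.

Record cosheaf_hom (C D : cosheaf_obj) := CosheafHom {
  base_map : base C -> base D;
  base_map_le : forall x y, (x <= y)%O -> (base_map x <= base_map y)%O;
  component : forall x, costalk C x -> costalk D (base_map x);
  component_natural : forall x y (h : (x <= y)%O) (c : costalk C y),
    extension D (base_map_le h) (component c) = component (extension C h c) }.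
Arguments base_map {C D} _ _.
Arguments component {C D} _ _ _.

Definition cosheaf_id (C : cosheaf_obj) : cosheaf_hom C C :=
  @CosheafHom C C id (fun _ _ h => h) (fun _ c => c) (fun _ _ _ _ => erefl).

Lemma cosheaf_comp_natural (C D E : cosheaf_obj)
    (n : cosheaf_hom D E) (m : cosheaf_hom C D)
    (x y : base C) (h : (x <= y)%O) (c : costalk C y) :
  extension E (base_map_le n (base_map_le m h))
    (component n _ (component m _ c)) =
  component n _ (component m _ (extension C h c)).
Proof. by rewrite component_natural component_natural. Qed.

Definition cosheaf_comp (C D E : cosheaf_obj)
    (n : cosheaf_hom D E) (m : cosheaf_hom C D) : cosheaf_hom C E :=
  @CosheafHom C E (base_map n \o base_map m)
    (fun _ _ h => base_map_le n (base_map_le m h))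
    (fun x c => component n _ (component m x c))
    (@cosheaf_comp_natural C D E n m).

Lemma cosheaf_comp_idl (C D : cosheaf_obj) (m : cosheaf_hom C D) :
  cosheaf_comp (cosheaf_id D) m = m.
Proof.
by case: m => f fle k kn; rewrite /cosheaf_comp /=; congr CosheafHom.
Qed.

Lemma cosheaf_comp_idr (C D : cosheaf_obj) (m : cosheaf_hom C D) :
  cosheaf_comp m (cosheaf_id C) = m.
Proof.
by case: m => f fle k kn; rewrite /cosheaf_comp /=; congr CosheafHom.
Qed.

Lemma cosheaf_comp_assoc (C D E F : cosheaf_obj) (p : cosheaf_hom E F)
    (n : cosheaf_hom D E) (m : cosheaf_hom C D) :
  cosheaf_comp p (cosheaf_comp n m) = cosheaf_comp (cosheaf_comp p n) m.
Proof. by rewrite /cosheaf_comp /=; congr CosheafHom. Qed.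

Definition CoShv : category :=
  @Category cosheaf_obj cosheaf_hom cosheaf_id cosheaf_comp
    cosheaf_comp_idl cosheaf_comp_idr cosheaf_comp_assoc.

Definition common_witnesses (A : relation) (s : set (rel_X A)) :
    set (rel_Y A) :=
  [set y | forall x, s x -> rel_R A (x, y)].

Definition simplices (A : relation) : set (set (rel_X A)) :=
  [set s | [/\ s !=set0, finite_set s &
               exists y, forall x, s x -> rel_R A (x, y)]].
Arguments simplices : clear implicits.

Definition dowker (A : relation) : Type := set_type (simplices A).

(* The order inherited from [set (rel_X A)] is inclusion ([subsetEset]). *)
HB.instance Definition _ (A : relation) := SubChoice.on (dowker A).
HB.instance Definition _ (A : relation) :=
  [SubChoice_isSubPOrder of dowker A by <: with set_display].

Definition dowker_costalk (A : relation) (s : dowker A) : Type :=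
  set_type (common_witnesses (val s)).

Lemma common_witnesses_le (A : relation) (s t : dowker A) :
  (s <= t)%O -> common_witnesses (val t) `<=` common_witnesses (val s).
Proof.
by rewrite -Order.le_val subsetEset => st y yt x /st; exact: yt.
Qed.

Definition dowker_extension (A : relation) (s t : dowker A) (h : (s <= t)%O)
    (y : dowker_costalk t) : dowker_costalk s :=
  exist _ (val y) (mem_set (common_witnesses_le h (set_mem (valP y)))).

Lemma dowker_extension_id (A : relation) (s : dowker A) (h : (s <= s)%O)
  (y : dowker_costalk s) : dowker_extension h y = y.
Proof. exact: val_inj. Qed.

Lemma dowker_extension_comp (A : relation) (s t u : dowker A)
  (hst : (s <= t)%O) (htu : (t <= u)%O) (hsu : (s <= u)%O)
  (y : dowker_costalk u) :
  dowker_extension hsu y = dowker_extension hst (dowker_extension htu y).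
Proof. exact: val_inj. Qed.

Definition CoShvRep0 (A : Rel) : CoShv :=
  @CosheafObj set_display (dowker A)
    (@Cosheaf _ (dowker A) (@dowker_costalk A) (@dowker_extension A)
       (@dowker_extension_id A) (@dowker_extension_comp A)).

Definition is_CoShvRep0_map (A B : Rel) (m : hom A B)
    (phi : hom (CoShvRep0 A) (CoShvRep0 B)) : Prop :=
  (forall s : dowker A,
     val (base_map phi s : dowker B) = hom_X m @` val s) /\
  (forall (s : dowker A) (y : dowker_costalk s),
     val (component phi s y : dowker_costalk (base_map phi s)) =
     hom_Y m (val y)).

(* Main.v *)
(* A cosheaf morphism into a Dowker cosheaf is determined by the underlying
   sets of its base map and the underlying elements of its components, so
   functoriality reduces to functoriality of images.  For faithfulness, the
   image of the vertex {x} is {f x}, which recovers f, and every y is a common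
   witness of some vertex {x}, where the component recovers g y. *)
Require Import Defs.
From mathcomp Require Import all_boot all_order.
From mathcomp Require Import boolp classical_sets functions cardinality.

Set Implicit Arguments.
Unset Strict Implicit.
Unset Printing Implicit Defensive.

Local Open Scope classical_set_scope.

Lemma rel_hom_ext (A B : relation) (m n : rel_hom A B) :
  hom_X m =1 hom_X n -> hom_Y m =1 hom_Y n -> m = n.
Proof.
case: m n => [f g fgR] [f' g' fgR'] /= /funext ff' /funext gg'.
by subst f' g'; congr RelHom; exact: Prop_irrelevance.
Qed.

(** The components of [phi] and [psi] have different codomains until the base maps are identified.
    Comparing their values in [rel_Y B] avoids transport along that identification. *)
Lemma cosheaf_hom_dowker_ext (C : cosheaf_obj) (B : relation)
    (phi psi : cosheaf_hom C (CoShvRep0 B)) :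
  (forall s, val (base_map phi s : dowker B) =
             val (base_map psi s : dowker B)) ->
  (forall s c,
     val (component phi s c : dowker_costalk (base_map phi s : dowker B)) =
     val (component psi s c : dowker_costalk (base_map psi s : dowker B))) ->
  phi = psi.
Proof.
case: phi psi => [f fle k kn] [f' fle' k' kn'] /= ff' kk'.
have {}ff' : f = f' by apply/funext => s; exact/val_inj/ff'.
subst f'.
have {}kk' : k = k'.
  by apply: functional_extensionality_dep => s; apply/funext => c;
     exact/val_inj/kk'.
(* The type of the naturality proof mentions the monotonicity proof, so the latter is identified
   first. *)
subst k'; rewrite (Prop_irrelevance fle' fle) in kn' *.
by congr CosheafHom; exact: Prop_irrelevance.
Qed.

Section DowkerMap.
Variables (A B : relation) (m : rel_hom A B).

(** This makes images of simplices simplices and also lets [hom_Y m] restrict to costalks. *)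
Lemma image_common_witnesses (s : set (rel_X A)) (y : rel_Y A) :
  common_witnesses s y -> common_witnesses (hom_X m @` s) (hom_Y m y).
Proof. by move=> sy _ [x sx <-]; exact/rel_homP/sy. Qed.

Lemma image_simplex (s : set (rel_X A)) :
  simplices A s -> simplices B (hom_X m @` s).
Proof.
case=> [[x sx] fs [y sy]]; split; first by exists (hom_X m x), x.
  exact: finite_image.
by exists (hom_Y m y); exact: image_common_witnesses.
Qed.

Definition dowker_map (s : dowker A) : dowker B :=
  exist _ (hom_X m @` val s) (mem_set (image_simplex (set_mem (valP s)))).

Lemma dowker_map_le (s t : dowker A) :
  (s <= t)%O -> (dowker_map s <= dowker_map t)%O.
Proof. by rewrite -!Order.le_val !subsetEset; exact: image_subset. Qed.

Definition dowker_component (s : dowker A) (y : dowker_costalk s) :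
    dowker_costalk (dowker_map s) :=
  exist _ (hom_Y m (val y))
    (mem_set (image_common_witnesses (set_mem (valP y)))).

Lemma dowker_component_natural (s t : dowker A) (h : (s <= t)%O)
    (y : dowker_costalk t) :
  dowker_extension (dowker_map_le h) (dowker_component y) =
  dowker_component (dowker_extension h y).
Proof. exact: val_inj. Qed.

Definition CoShvRep0_map : cosheaf_hom (CoShvRep0 A) (CoShvRep0 B) :=
  @CosheafHom (CoShvRep0 A) (CoShvRep0 B) dowker_map dowker_map_le
    dowker_component dowker_component_natural.

End DowkerMap.

(** Components agree by computation; only the base maps need a law of images. The same holds for
    composition. *)
Lemma CoShvRep0_map_id (A : relation) :
  CoShvRep0_map (rel_id A) = cosheaf_id (CoShvRep0 A).
Proof. by apply: cosheaf_hom_dowker_ext => //= s; rewrite image_id. Qed.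

Lemma CoShvRep0_map_comp (A B C : relation)
    (n : rel_hom B C) (m : rel_hom A B) :
  CoShvRep0_map (rel_comp n m) =
  cosheaf_comp (CoShvRep0_map n) (CoShvRep0_map m).
Proof. by apply: cosheaf_hom_dowker_ext => //= s; rewrite image_comp. Qed.

Definition CoShvRep0_functor : functor_on (C := Rel) (D := CoShv) CoShvRep0 :=
  @FunctorOn Rel CoShv CoShvRep0 CoShvRep0_map CoShvRep0_map_id
    CoShvRep0_map_comp.

Lemma vertex_simplex (A : relation) (x : rel_X A) (y : rel_Y A) :
  rel_R A (x, y) -> simplices A [set x].
Proof.
move=> xy; split; [by exists x | exact: finite_set1 |].
by exists y => _ ->.
Qed.

(** The argument [xy] is required because a point related to nothing spans no simplex. *)
Definition vertex (A : relation) (x : rel_X A) (y : rel_Y A)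
    (xy : rel_R A (x, y)) : dowker A :=
  exist _ [set x] (mem_set (vertex_simplex xy)).

Lemma CoShvRep0_map_inj (A B : relation) :
  in_Rel_plus A -> injective (@CoShvRep0_map A B).
Proof.
move=> [hasY hasX] m n mn; apply: rel_hom_ext => [x|y].
  have [y xy] := hasY x.
  (* Evaluation at the vertex followed by [val] lands in [set (rel_X B)], a type independent of [p],
     so [congr1] applies. *)
  have := congr1 (fun p : cosheaf_hom (CoShvRep0 A) (CoShvRep0 B) =>
    val (base_map p (vertex xy) : dowker B)) mn.
  rewrite /= !image_set1 => mnx.
  by have : [set hom_X n x] (hom_X m x) by rewrite -mnx.
have [x xy] := hasX y.
have ywit : common_witnesses (val (vertex xy)) y by move=> _ ->.
pose c : dowker_costalk (vertex xy) := exist _ y (mem_set ywit).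
by have := congr1 (fun p : cosheaf_hom (CoShvRep0 A) (CoShvRep0 B) =>
  val (component p (vertex xy) c :
    dowker_costalk (base_map p (vertex xy) : dowker B))) mn.
Qed.

Theorem theorem4 :
  exists F : functor_on (C := Rel) (D := CoShv) CoShvRep0,
    (forall (A B : Rel) (m : hom A B), is_CoShvRep0_map m (fmap F m)) /\
    faithful (functor_restrict F in_Rel_plus : functor_on (C := Rel_plus) _).
Proof.
exists CoShvRep0_functor; split=> [A B m|[A A_plus] B]; first by split.
exact: CoShvRep0_map_inj.
Qed.
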